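(* Let $\varphi:M_2(\mathbb{C})\to M_2(\mathbb{C})$ be an extremal point of the convex set $\mathcal{P}_1$ of positive unital linear maps $M_2(\mathbb{C})\to M_2(\mathbb{C})$, and let $V,W\in U(2)$ be unitary matrices such that the Choi matrix of $\varphi_{V,W}:A\mapsto V^*\varphi(WAW^* )V$ is $$\left[\begin{array}{cc|cc}1&0&0&y\\0&b&\overline{z}&t\\ \hline 0&z&0&0\\ \overline{y}&\overline{t}&0&u\end{array}\right]$$ where $b\ge 0$, $u\ge 0$, $b+u=1$, $y,z,t\in\mathbb{C}$, and where $|t|^2=2b(u-|y|^2-|z|^2)$ if $b\neq 0$, while $|y|=1$ or $|z|=1$ if $b=0$. Put $\xi=We_2$ and $\eta=Ve_1$. Assume that $u>0$, $y\neq 0$ and $z\neq 0$. Then there are $\varphi_1,\varphi_2\in F_{\xi,\eta}$ such that $\varphi_1$ is completely positive, $\varphi_2$ is completely copositive and $\varphi=\varphi_1+\varphi_2$. Moreover, the pair $(\varphi_1,\varphi_2)$ is uniquely determined, and the Choi matrices $\mathbf{H}_1$ and $\mathbf{H}_2$ of $(\varphi_1)_{V,W}$ and $(\varphi_2)_{V,W}$ have the form $$\mathbf{H}_1=\left[\begin{array}{cc|cc}|y|u^{-1/2}&c&0&y\\ \overline{c}&|z|(1-u)u^{-1/2}&0&\frac12 t\\ \hline 0&0&0&0\\ \overline{y}&\frac12\overline{t}&0&|y|u^{1/2}\end{array}\right],$$ $$\mathbf{H}_2=\left[\begin{array}{cc|cc}|z|u^{-1/2}&-c&0&0\\ -\overline{c}&|y|(1-u)u^{-1/2}&\overline{z}&\frac12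 t\\ \hline 0&z&0&0\\ 0&\frac12\overline{t}&0&|z|u^{1/2}\end{array}\right]$$ for some complex number $c$ (the same in both matrices) such that $c^2=-(1-u)u^{-1}yz$.
   Context: A linear map $\psi:M_2(\mathbb{C})\to M_2(\mathbb{C})$ is positive if it sends positive semidefinite matrices to positive semidefinite matrices, and unital if $\psi(\mathbb{I})=\mathbb{I}$. It is completely positive (resp. completely copositive) if for every $k\in\mathbb{N}$ and every positive element $[A_{ij}]_{i,j=1}^k$ of $M_k(M_2(\mathbb{C}))$ the block matrix $[\psi(A_{ij})]_{i,j=1}^k$ (resp. $[\psi(A_{ji})]_{i,j=1}^k$) is positive in $M_k(M_2(\mathbb{C}))$. $\mathcal{P}_1$ denotes the convex set of all positive unital maps on $M_2(\mathbb{C})$. The Choi matrix of a linear map $\psi$ is the $2\times 2$ block matrix $[\psi(E_{ij})]_{i,j=1}^2\in M_2(M_2(\mathbb{C}))\cong M_4(\mathbb{C})$, where $E_{ij}$ are the standard matrix units; the lines in the displayed matrices separate the blocks. $\{e_1,e_2\}$ is the canonical basis of $\mathbb{C}^2$. For a linear map $\psi$ and unitaries $V,W$, $\psi_{V,W}(A)=V^*\psi(WAW^* )V$. For nonzero vectors $\xi,\eta\in\mathbb{C}^2$, $F_{\xi,\eta}$ is the set of all positive maps $\psi:M_2(\mathbb{C})\to M_2(\mathbb{C})$ with $\psi(P_\xi)\eta=0$, where $P_\xi$ is the orthogonal projection onto the line spanned by $\xi$. *)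

(* Defs.v *)
From HB Require Import structures.
From mathcomp Require Import all_boot all_order all_algebra.

Set Implicit Arguments.
Unset Strict Implicit.
Unset Printing Implicit Defensive.

Import Order.TTheory GRing.Theory Num.Theory.
Local Open Scope ring_scope.
Local Open Scope sesquilinear_scope.

(* In a numClosedFieldType, 0 <= x entails that x is real. *)

Section ExtremalPoints.
Context {C : numClosedFieldType} {E : lmodType C}.

(* The condition 0 < a < 1 forces a to be real, so these are real convex
   combinations. *)
Definition extremal_point (K : E -> Prop) (x : E) : Prop :=
  K x /\
  forall (y z : E) (a : C), K y -> K z -> 0 < a < 1 ->
    x = a *: y + (1 - a) *: z -> y = x /\ z = x.

End ExtremalPoints.

Section PositiveMaps.
Context {C : numClosedFieldType}.

(* The inequality makes every v^* A v real, so A is automatically Hermitian. *)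
Definition psdmx (n : nat) (A : 'M[C]_n) : Prop :=
  forall v : 'cV[C]_n, 0 <= (v^t* *m A *m v) 0 0.

Definition positive_map (psi : 'End('M[C]_2)) : Prop :=
  forall A : 'M[C]_2, psdmx A -> psdmx (psi A).

Definition unital_map (psi : 'End('M[C]_2)) : Prop := psi 1%:M = 1%:M.

(* M_k(M_2(C)) is identified with M_{2k}(C) through \mxblock. *)
Definition completely_positive (psi : 'End('M[C]_2)) : Prop :=
  forall (k : nat) (A : 'I_k -> 'I_k -> 'M[C]_2),
    psdmx (\mxblock_(i < k, j < k) A i j) ->
    psdmx (\mxblock_(i < k, j < k) psi (A i j)).

Definition completely_copositive (psi : 'End('M[C]_2)) : Prop :=
  forall (k : nat) (A : 'I_k -> 'I_k -> 'M[C]_2),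
    psdmx (\mxblock_(i < k, j < k) A i j) ->
    psdmx (\mxblock_(i < k, j < k) psi (A j i)).

Definition P1 (psi : 'End('M[C]_2)) : Prop :=
  positive_map psi /\ unital_map psi.

Definition twist (V W : 'M[C]_2) (psi : 'End('M[C]_2)) (A : 'M[C]_2) :
    'M[C]_2 :=
  V^t* *m psi (W *m A *m W^t*) *m V.

Definition choi (f : 'M[C]_2 -> 'M[C]_2) : 'M[C]_(2 + 2) :=
  block_mx (f (delta_mx 0 0)) (f (delta_mx 0 1))
           (f (delta_mx 1 0)) (f (delta_mx 1 1)).

(* Orthogonal projection onto the line spanned by x, for x != 0. *)
Definition proj_line (x : 'cV[C]_2) : 'M[C]_2 :=
  ((x^t* *m x) 0 0)^-1 *: (x *m x^t*).

Definition Fface (xi eta : 'cV[C]_2) (psi : 'End('M[C]_2)) : Prop :=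
  positive_map psi /\ psi (proj_line xi) *m eta = 0.

Definition decomposition (phi : 'End('M[C]_2)) (xi eta : 'cV[C]_2)
    (p : 'End('M[C]_2) * 'End('M[C]_2)) : Prop :=
  [/\ Fface xi eta p.1, Fface xi eta p.2,
      completely_positive p.1, completely_copositive p.2
    & phi = p.1 + p.2].

Definition mx2 (a b c d : C) : 'M[C]_2 :=
  \matrix_(i, j) if i == 0 then (if j == 0 then a else b)
                 else (if j == 0 then c else d).

End PositiveMaps.

(* Main.v *)
Require Import Defs.
From HB Require Import structures.
From mathcomp Require Import all_boot all_order all_algebra.
From mathcomp Require Import complex.
From mathcomp Require Import reals.
From mathcomp Require Import ring lra.

(** Write psi for the twisted map, and m for |y| + |z|.

    Positivity already pins down the data.  Testing psi on the projections onto
    (1, x) gives |y x^* + z x|^2 <= b + 2 Re (t x^* ) + u |x|^2 for every complex x.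
    The left side is a real quadratic form with eigenvalues m^2 and (|y| - |z|)^2,
    and large x show that u >= m^2.  If u exceeded m^2, completing squares along the
    eigenlines would bound |t|^2 by b (u - (|y| - |z|)^2), which is smaller than the
    prescribed value 2 b (u - |y|^2 - |z|^2).  Hence u = m^2, and t has no component
    along the first eigenline, which fixes its phase: t^2 = - 4 b y z^*
    (positivity_tangency).

    Let a decomposition be given.  The Choi matrix of the completely positive
    summand, and the partially transposed Choi matrix of the completely copositive
    one, are positive semidefinite, and the face condition kills their third
    diagonal entry, so their third rows and columns vanish.  Consequently y sits
    entirely in the first and z in the second.  With a1, a2 and u1, u2 the extreme
    diagonal entries, a1 + a2 = 1, u1 + u2 = m^2, a1 u1 >= |y|^2 and a2 u2 >= |z|^2;
    equality in Cauchy-Schwarz determines all four and makes two minors vanish, so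
    each corner entry is a multiple of the off-diagonal entry c of its matrix.  The
    parallelogram law together with the value of |t|^2 forces the two corners to
    coincide, and everything else follows (cauchy_schwarz_eq, splitting_forced).

    The two matrices so found have rank one, hence they come from maps with a single
    Kraus operator, composed with the transposition in the second case.  Such maps
    are visibly completely positive, respectively copositive, and lie in the face;
    that is existence (choi_cp_root, choi_cocp_root). *)

Set Implicit Arguments.
Unset Strict Implicit.
Unset Printing Implicit Defensive.

Import Order.TTheory GRing.Theory Num.Theory.
Local Open Scope ring_scope.
Local Open Scope sesquilinear_scope.

Lemma big_ord2 (V : nmodType) (F : 'I_2 -> V) : \sum_i F i = F 0 + F 1.
Proof.
rewrite big_ord_recl big_ord1; congr (_ + F _); exact: val_inj.
Qed.

Lemma ord2P (i : 'I_2) : i = 0 \/ i = 1.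
Proof. by case: i => -[|[|//]] ?; [left|right]; apply: val_inj. Qed.

(** * Positive semidefinite matrices *)

Section PsdMatrices.
Context {C : numClosedFieldType}.

Lemma trmxC_mul m n p (A : 'M[C]_(m, n)) (B : 'M[C]_(n, p)) :
  (A *m B)^t* = B^t* *m A^t*.
Proof. by rewrite trmx_mul map_mxM. Qed.

Lemma trmxCD m n (A B : 'M[C]_(m, n)) : (A + B)^t* = A^t* + B^t*.
Proof. by rewrite linearD /= map_mxD. Qed.

Lemma trmxCZ m n (k : C) (A : 'M[C]_(m, n)) : (k *: A)^t* = k^* *: A^t*.
Proof. by rewrite linearZ /= map_mxZ. Qed.

Lemma trmxC11 (A : 'M[C]_1) : A^t* 0 0 = (A 0 0)^*.
Proof. by rewrite !mxE. Qed.

Lemma unitarymxPV n (V : 'M[C]_n) : V \is unitarymx -> V^t* *m V = 1%:M.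
Proof. by rewrite -trmxC_unitary => /unitarymxP; rewrite trmxCK. Qed.

(** This form stays uncurried in both vectors, because polarisation and block
    sums need its off-diagonal values as well as the squares that occur in
    psdmx. *)
Definition qform n (A : 'M[C]_n) (v w : 'cV[C]_n) : C := (v^t* *m A *m w) 0 0.

Lemma qformE n (A : 'M[C]_n) v w :
  qform A v w = \sum_i \sum_j (v i 0)^* * A i j * w j 0.
Proof.
rewrite /qform -mulmxA mxE; apply: eq_bigr => i _.
by rewrite !mxE big_distrr /=; apply: eq_bigr => j _; rewrite !mulrA.
Qed.

Lemma qform_deltal n (A : 'M[C]_n) i w :
  qform A (delta_mx i 0) w = (A *m w) i 0.
Proof.
rewrite /qform -mulmxA trmx_delta map_delta_mx.
by rewrite -[in LHS](rowE i (A *m w)) mxE.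
Qed.

Lemma qform_delta n (A : 'M[C]_n) i j :
  qform A (delta_mx i 0) (delta_mx j 0) = A i j.
Proof. by rewrite qform_deltal -colE mxE. Qed.

Lemma qformDl n (A : 'M[C]_n) v v' w :
  qform A (v + v') w = qform A v w + qform A v' w.
Proof. by rewrite /qform trmxCD !mulmxDl mxE. Qed.

Lemma qformDr n (A : 'M[C]_n) v w w' :
  qform A v (w + w') = qform A v w + qform A v w'.
Proof. by rewrite /qform mulmxDr mxE. Qed.

Lemma qformZl n (A : 'M[C]_n) k v w : qform A (k *: v) w = k^* * qform A v w.
Proof. by rewrite /qform trmxCZ -!scalemxAl mxE. Qed.

Lemma qformZr n (A : 'M[C]_n) k v w : qform A v (k *: w) = k * qform A v w.
Proof. by rewrite /qform -scalemxAr mxE. Qed.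

Definition qformL := (@qformDl, @qformDr, @qformZl, @qformZr).

(** Polarisation: the form is real at v, w, v + w and v + 'i w, and these four
    conditions determine the antisymmetric part. *)
Lemma psdmx_herm n (A : 'M[C]_n) v w :
  psdmx A -> qform A w v = (qform A v w)^*.
Proof.
move=> psdA.
have re x : (qform A x x)^* = qform A x x by apply/geC0_conj/psdA.
have := re (v + w); have := re (v + 'i *: w).
rewrite !qformL !(rmorphD, rmorphM) /= !re conjCK conjCi.
set X := qform A v w; set Y := qform A w v => e1 e2.
have {}e2 : X^* + Y^* = X + Y.
  apply: (addrI (qform A v v)); apply: (addIr (qform A w w)).
  by move: e2; rewrite !addrA.
have {}e1 : 'i * (Y^* - X^*) = 'i * (X - Y).
  apply: (addrI (qform A v v)); apply: (addIr ('i * (- 'i * qform A w w))).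
  by apply: etrans (etrans e1 _); ring.
have {}e1 := mulfI (neq0Ci C) e1.
have two0 : 2 != 0 :> C by rewrite pnatr_eq0.
apply: (mulfI two0).
have -> : 2 * Y = (X + Y) - (X - Y) by ring.
by rewrite -e1 -e2; ring.
Qed.

(** A nonnegative form that vanishes at v is minimal there, hence its
    differential A v vanishes.  Concretely, if the i-th coordinate a of A v were
    nonzero, moving from the i-th basis vector far enough in the direction of v
    would make the form negative. *)
Lemma psdmx_ker n (A : 'M[C]_n) v : psdmx A -> qform A v v = 0 -> A *m v = 0.
Proof.
move=> psdA v0; apply/eqP; apply: contraT => Av0.
pose w := A *m v.
have [i wi0] : exists i, w i 0 != 0.
  apply/existsP; apply: contraR Av0; rewrite negb_exists => /forallP h.
  apply/eqP/matrixP => i j; rewrite ord1 [RHS]mxE; apply/eqP.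
  by have := h i; rewrite negbK.
pose e := delta_mx i 0 : 'cV[C]_n.
have ev : qform A e v = w i 0 by rewrite qform_deltal.
have ve : qform A v e = (w i 0)^* by rewrite -ev -psdmx_herm.
set a := w i 0 in ev ve wi0.
(* With this factor the value at - s a^* v + e is - qform A e e - 2. *)
pose s := (qform A e e + 1) / (a * a^*).
have s_ge0 : 0 <= s.
  by rewrite divr_ge0 ?mul_conjC_ge0// addr_ge0// psdA.
have /= := psdA (- s * a^* *: v + e); rewrite -/(qform _ _ _) !qformL v0 ev ve.
rewrite rmorphM rmorphN /= conjCK (geC0_conj s_ge0).
rewrite mulr0 mulr0 add0r => h.
suff : 0 <= - (qform A e e + 2) :> C.
  by rewrite oppr_ge0 lt_geF// ltr_wpDl ?ltr0n// psdA.
suff -> : - (qform A e e + 2) = - s * a * a^* + (- s * a^* * a + qform A e e).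
  by move: h; rewrite !addrA.
have sE : s * (a * a^*) = qform A e e + 1 by rewrite divfK// mul_conjC_eq0.
transitivity (- 2 * (s * (a * a^*)) + qform A e e); last by ring.
by rewrite sE; ring.
Qed.

Lemma psdmx_diag_ge0 n (A : 'M[C]_n) i : psdmx A -> 0 <= A i i.
Proof. by move=> psdA; rewrite -qform_delta psdA. Qed.

Lemma psdmx_conj n (A : 'M[C]_n) i j : psdmx A -> A j i = (A i j)^*.
Proof. by move=> psdA; rewrite -!qform_delta psdmx_herm. Qed.

Lemma psdmx_diag0 n (A : 'M[C]_n) i j : psdmx A -> A i i = 0 -> A j i = 0.
Proof.
move=> psdA Aii0; have := psdmx_ker (v := delta_mx i 0) psdA.
by rewrite qform_delta => /(_ Aii0); rewrite -colE => /matrixP/(_ j 0); rewrite !mxE.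
Qed.

(** On the plane of the coordinates i and j, this vector spans the kernel of the
    2 x 2 principal block when its determinant is 0 and A i i is not. *)
Let minor_vector n (A : 'M[C]_n) i j : 'cV[C]_n :=
  A i j *: delta_mx i 0 - A i i *: delta_mx j 0.

Lemma qform_minor n (A : 'M[C]_n) i j : psdmx A ->
  let v := minor_vector A i j in
  qform A v v = A i i * (A i i * A j j - `|A i j| ^+ 2).
Proof.
move=> psdA v; rewrite /v /minor_vector -scaleNr !qformL !qform_delta.
rewrite (psdmx_conj i j psdA) normCK rmorphN /= (geC0_conj (psdmx_diag_ge0 i psdA)).
ring.
Qed.

Lemma psdmx_minor n (A : 'M[C]_n) i j :
  psdmx A -> `|A i j| ^+ 2 <= A i i * A j j.
Proof.
move=> psdA; have Aii_ge0 := psdmx_diag_ge0 i psdA.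
move: (Aii_ge0); rewrite le_eqVlt => /predU1P[/esym Aii0|Aii_gt0].
  by rewrite psdmx_conj// psdmx_diag0// Aii0 conjC0 normr0 expr0n mul0r.
have := psdA (minor_vector A i j); rewrite -/(qform _ _ _) qform_minor//.
by rewrite pmulr_rge0// subr_ge0.
Qed.

(** When the principal minor vanishes, so does the form at the minor vector,
    which then lies in the kernel of A; the identity is the k-th coordinate of
    that kernel equation. *)
Lemma psdmx_minor_eq n (A : 'M[C]_n) i j k : psdmx A ->
  A i i * A j j = `|A i j| ^+ 2 -> A i i * A k j = A i j * A k i.
Proof.
move=> psdA minor0.
have := psdmx_ker (v := minor_vector A i j) psdA.
rewrite qform_minor// minor0 subrr mulr0 => /(_ erefl)/matrixP/(_ k 0).
rewrite mulmxBr -!scalemxAr -!colE !mxE => /eqP.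
by rewrite subr_eq0 => /eqP ->.
Qed.

End PsdMatrices.

(** * Complete positivity and Choi matrices *)

Section CompletePositivity.
Context {C : numClosedFieldType}.

Lemma qform_block n1 n2 (A : 'M[C]_n1) (B : 'M_(n1, n2)) (D : 'M_(n2, n1))
    (E : 'M_n2) v1 v2 w1 w2 :
  qform (block_mx A B D E) (col_mx v1 v2) (col_mx w1 w2) =
  qform A v1 w1 + (v1^t* *m B *m w2) 0 0 +
  ((v2^t* *m D *m w1) 0 0 + qform E v2 w2).
Proof.
rewrite /qform tr_col_mx map_row_mx mul_row_block mul_row_col !mulmxDl !mxE.
by rewrite addrACA.
Qed.

(** A vector of the big space is a family of blocks, so positivity of a block
    matrix can be tested on families of vectors of the small space. *)
Lemma psdmx_mxblock k (A : 'I_k -> 'I_k -> 'M[C]_2) :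
  psdmx (\mxblock_(i < k, j < k) A i j) <->
  forall v : 'I_k -> 'cV[C]_2, 0 <= \sum_i \sum_j qform (A i j) (v i) (v j).
Proof.
have mxcolE (v : 'I_k -> 'cV[C]_2) :
    qform (\mxblock_(i, j) A i j) (\mxcol_i v i) (\mxcol_i v i) =
    \sum_i \sum_j qform (A i j) (v i) (v j).
  have -> : qform (\mxblock_(i, j) A i j) (\mxcol_i v i) (\mxcol_i v i) =
      (\sum_i (v i)^t* *m \sum_j (A i j *m v j)) 0 0.
    rewrite /qform tr_mxcol.
    have -> : map_mx Num.conj (\mxrow_i (v i)^T) = \mxrow_i (v i)^t*.
      by apply/matrixP => i j; rewrite !mxE.
    rewrite -mulmxA; congr (fun_of_matrix _ 0 0).
    rewrite mxblockEv mxcol_mul mul_mxrow_mxcol; apply: eq_bigr => i _.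
    by rewrite mul_mxrow_mxcol.
  rewrite summxE; apply: eq_bigr => i _; rewrite mulmx_sumr summxE.
  by apply: eq_bigr => j _; rewrite /qform mulmxA.
split=> [psdA v|psdA v].
  by rewrite -mxcolE; apply: psdA.
by rewrite -/(qform _ _ _) -(submxcolK v) mxcolE.
Qed.

Lemma psdmx_choi (f : 'M[C]_2 -> 'M[C]_2) :
  (forall v : 'I_2 -> 'cV[C]_2,
     0 <= \sum_i \sum_j qform (f (delta_mx i j)) (v i) (v j)) ->
  psdmx (choi f).
Proof.
move=> f_ge0 v; rewrite -(vsubmxK v) -/(qform _ _ _) /choi qform_block.
have := f_ge0 (fun i => if i == 0 then usubmx v else dsubmx v).
by rewrite !big_ord2.
Qed.

(** The block matrix of matrix units has rank at most one: its form is the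
    squared modulus of a linear functional.  The conjugation by W
    provides the input that a twisted Choi matrix needs. *)
Lemma psdmx_matrix_units (W : 'M[C]_2) :
  psdmx (\mxblock_(i < 2, j < 2) (W *m delta_mx i j *m W^t*)).
Proof.
apply/psdmx_mxblock => v.
pose a i : C := ((v i)^t* *m W *m delta_mx i (0 : 'I_1)) 0 0.
suff -> : \sum_i \sum_j qform (W *m delta_mx i j *m W^t*) (v i) (v j) =
          (\sum_i a i) * (\sum_i a i)^*.
  exact: mul_conjC_ge0.
rewrite rmorph_sum big_distrl; apply: eq_bigr => i _; rewrite big_distrr /=.
apply: eq_bigr => j _.
have -> : (a j)^* = (delta_mx (0 : 'I_1) j *m W^t* *m v j) 0 0.
  by rewrite -trmxC11 !trmxC_mul trmxCK trmx_delta map_delta_mx mulmxA.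
rewrite /qform -(mul_delta_mx (0 : 'I_1)) !mulmxA.
rewrite -(mulmxA _ (delta_mx 0 j)) -(mulmxA _ _ (v j)) mxE big_ord1.
by rewrite /a ?mulmxA.
Qed.

Lemma qform_twist (V W : 'M[C]_2) psi A v w :
  qform (twist V W psi A) v w = qform (psi (W *m A *m W^t*)) (V *m v) (V *m w).
Proof. by rewrite /qform /twist trmxC_mul !mulmxA. Qed.

Lemma completely_positive_choi (V W : 'M[C]_2) psi :
  completely_positive psi -> psdmx (choi (twist V W psi)).
Proof.
move=> cp; apply: psdmx_choi => v.
have /psdmx_mxblock/(_ (fun i => V *m v i)) := cp _ _ (psdmx_matrix_units W).
by under eq_bigr do under eq_bigr do rewrite -qform_twist.
Qed.

(** The blocks of the Choi matrix come out transposed, which is the Choi matrix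
    of the map precomposed with the transposition. *)
Lemma completely_copositive_choi (V W : 'M[C]_2) psi :
  completely_copositive psi -> psdmx (choi (twist V W psi \o trmx)).
Proof.
move=> cocp; apply: psdmx_choi => v.
have /psdmx_mxblock/(_ (fun i => V *m v i)) := cocp _ _ (psdmx_matrix_units W).
under eq_bigr do under eq_bigr do rewrite -qform_twist.
by under eq_bigr do under eq_bigr do rewrite -trmx_delta.
Qed.

(** Maps with a single Kraus operator, and their compositions with the
    transposition: the two summands of the decomposition have these forms. *)
Definition congr_map (S : 'M[C]_2) : 'End('M[C]_2) :=
  linfun (mulmx S \o mulmxr (S^t*)).

Definition cocongr_map (S : 'M[C]_2) : 'End('M[C]_2) :=
  linfun (mulmx S \o (mulmxr (S^t*) \o trmx)).

Lemma congr_mapE S A : congr_map S A = S *m A *m S^t*.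
Proof. by rewrite lfunE /= mulmxA. Qed.

Lemma cocongr_mapE S A : cocongr_map S A = S *m A^T *m S^t*.
Proof. by rewrite lfunE /= mulmxA. Qed.

Lemma qform_congr (S A : 'M[C]_2) v w :
  qform (S *m A *m S^t*) v w = qform A (S^t* *m v) (S^t* *m w).
Proof. by rewrite /qform trmxC_mul trmxCK !mulmxA. Qed.

Lemma qform_tr n (A : 'M[C]_n) v w :
  qform A^T v w = qform A (map_mx Num.conj w) (map_mx Num.conj v).
Proof.
transitivity (((map_mx Num.conj v)^T *m A^T *m w)^T 0 0).
  by rewrite [RHS]mxE map_trmx.
rewrite !trmx_mul !trmxK mulmxA /qform; congr (_ 0 0); congr (_ *m _ *m _).
by apply/matrixP => i j; rewrite !mxE conjCK.
Qed.

Lemma congr_map_cp S : completely_positive (congr_map S).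
Proof.
move=> k A /psdmx_mxblock psdA; apply/psdmx_mxblock => v.
under eq_bigr do under eq_bigr do rewrite congr_mapE qform_congr.
exact: psdA.
Qed.

Lemma cocongr_map_cocp S : completely_copositive (cocongr_map S).
Proof.
move=> k A /psdmx_mxblock psdA; apply/psdmx_mxblock => v.
under eq_bigr do under eq_bigr do rewrite cocongr_mapE qform_congr qform_tr.
rewrite exchange_big; exact: (psdA (fun i => map_mx Num.conj (S^t* *m v i))).
Qed.

Lemma congr_map_pos S : positive_map (congr_map S).
Proof. by move=> A psdA v; rewrite -/(qform _ _ _) congr_mapE qform_congr psdA. Qed.

Lemma cocongr_map_pos S : positive_map (cocongr_map S).
Proof.
by move=> A psdA v; rewrite -/(qform _ _ _) cocongr_mapE qform_congr qform_tr psdA.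
Qed.

End CompletePositivity.

(** * Change of orthonormal bases *)

Section Twist.
Context {C : numClosedFieldType}.
Variables V W : 'M[C]_2.
Hypotheses (V_unitary : V \is unitarymx) (W_unitary : W \is unitarymx).

(** The twist loses no information since V and W are unitary. *)
Lemma twistK (psi : 'End('M[C]_2)) A :
  psi A = V *m twist V W psi (W^t* *m A *m W) *m V^t*.
Proof.
rewrite /twist !mulmxA (unitarymxP V_unitary) (unitarymxP W_unitary) !mul1mx.
by rewrite -!mulmxA (unitarymxP V_unitary) (unitarymxP W_unitary) !mulmx1.
Qed.

Lemma twist_sum psi A :
  twist V W psi A = \sum_i \sum_j A i j *: twist V W psi (delta_mx i j).
Proof.
rewrite {1}(matrix_sum_delta A) /twist mulmx_sumr mulmx_suml linear_sum.
rewrite mulmx_sumr mulmx_suml; apply: eq_bigr => i _.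
rewrite mulmx_sumr mulmx_suml linear_sum mulmx_sumr mulmx_suml.
apply: eq_bigr => j _.
by rewrite -scalemxAr -scalemxAl linearZ /= -scalemxAr -scalemxAl.
Qed.

Lemma choi_twist_inj psi psi' :
  choi (twist V W psi) = choi (twist V W psi') -> psi = psi'.
Proof.
move=> /eq_block_mx[e00 e01 e10 e11]; apply/lfunP => A.
rewrite twistK [RHS]twistK twist_sum [twist _ _ psi' _]twist_sum.
by rewrite !big_ord2 e00 e01 e10 e11.
Qed.

Lemma twistD (psi psi' : 'End('M[C]_2)) A :
  twist V W (psi + psi') A = twist V W psi A + twist V W psi' A.
Proof. by rewrite /twist lfunE /= mulmxDr mulmxDl. Qed.

(** In the twisted picture the line of the face is spanned by the second basis
    vector and the annihilated vector is the first one, so the face condition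
    only concerns the last block of the Choi matrix. *)
Lemma Fface_twist (psi : 'End('M[C]_2)) :
  psi (proj_line (W *m (delta_mx 1 0 : 'cV_2))) *m (V *m (delta_mx 0 0 : 'cV_2)) =
  V *m (twist V W psi (delta_mx 1 1) *m (delta_mx 0 0 : 'cV_2)).
Proof.
have -> : proj_line (W *m (delta_mx 1 0 : 'cV_2)) = W *m delta_mx 1 1 *m W^t*.
  rewrite /proj_line trmxC_mul -mulmxA (mulmxA (W^t*)) unitarymxPV// mul1mx.
  rewrite trmx_delta map_delta_mx mul_delta_mx mxE invr1 scale1r.
  by rewrite !mulmxA -(mulmxA W) mul_delta_mx.
by rewrite /twist !mulmxA (unitarymxP V_unitary) mul1mx.
Qed.

Lemma Fface_twist_eq0 (psi : 'End('M[C]_2)) :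
  psi (proj_line (W *m (delta_mx 1 0 : 'cV_2))) *m (V *m (delta_mx 0 0 : 'cV_2)) = 0 <->
  col 0 (twist V W psi (delta_mx 1 1)) = 0.
Proof.
rewrite Fface_twist colE; split=> [V0|->]; last by rewrite mulmx0.
by rewrite -[LHS]mul1mx -(unitarymxPV V_unitary) -mulmxA V0 mulmx0.
Qed.

Lemma twist_congr_map S A :
  twist V W (congr_map (V *m S *m W^t*)) A = S *m A *m S^t*.
Proof.
rewrite /twist congr_mapE !trmxC_mul trmxCK !mulmxA unitarymxPV// mul1mx.
by rewrite !mulmxKtV.
Qed.

(** The unitary on the right is W^T and not W^t*: the transposition exchanges the
    two sides of the argument. *)
Lemma twist_cocongr_map S A :
  twist V W (cocongr_map (V *m S *m W^T)) A = S *m A^T *m S^t*.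
Proof.
have WT : W^T \is unitarymx by rewrite trmx_unitary.
rewrite /twist cocongr_mapE !trmxC_mul !trmx_mul.
have -> : (W^t*)^T = (W^T)^t* by apply/matrixP => i j; rewrite !mxE.
by rewrite !mulmxA unitarymxPV// mul1mx mulmxKtV// !mulmxtVK.
Qed.
End Twist.

(** * Choi matrices with a vanishing diagonal entry *)

Section FaceChoi.
Context {C : numClosedFieldType}.

Lemma mx2E (A : 'M[C]_2) : A = mx2 (A 0 0) (A 0 1) (A 1 0) (A 1 1).
Proof.
apply/matrixP => i j; rewrite mxE.
by case: (ord2P i) => ->; case: (ord2P j) => ->.
Qed.

Lemma mx2D (a b c d a' b' c' d' : C) :
  mx2 a b c d + mx2 a' b' c' d' = mx2 (a + a') (b + b') (c + c') (d + d').
Proof. by rewrite [LHS]mx2E !mxE. Qed.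

Lemma mx2_inj (a b c d a' b' c' d' : C) :
  mx2 a b c d = mx2 a' b' c' d' -> [/\ a = a', b = b', c = c' & d = d'].
Proof.
move=> /matrixP e.
by move: (e 0 0) (e 0 1) (e 1 0) (e 1 1); rewrite !mxE.
Qed.

(** A positive semidefinite matrix whose third diagonal entry vanishes has no
    third row or column; these six parameters are what remains. *)
Definition face_choi (a b c y t u : C) : 'M[C]_(2 + 2) :=
  block_mx (mx2 a c c^* b) (mx2 0 y 0 t) (mx2 0 0 y^* t^*) (mx2 0 0 0 u).

Let i0 : 'I_(2 + 2) := lshift 2 0.
Let i1 : 'I_(2 + 2) := lshift 2 1.
Let i2 : 'I_(2 + 2) := rshift 2 0.
Let i3 : 'I_(2 + 2) := rshift 2 1.

Lemma psdmx_face_choi (H : 'M[C]_(2 + 2)) : psdmx H -> H i2 i2 = 0 ->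
  H = face_choi (H i0 i0) (H i1 i1) (H i0 i1) (H i0 i3) (H i1 i3) (H i3 i3).
Proof.
move=> psdH H22.
have r2 i : H i i2 = 0 by apply: psdmx_diag0.
have l2 i : H i2 i = 0 by rewrite (psdmx_conj i) // r2 conjC0.
rewrite /face_choi -!(psdmx_conj _ _ psdH) -[LHS]submxK.
by congr block_mx; rewrite [LHS]mx2E !mxE ?r2 ?l2.
Qed.

(** The inequalities are principal minors.  The last clause is the rigidity used
    later: once the minor of a and u vanishes, t is determined by c. *)
Lemma psdmx_choi_face (f : 'M[C]_2 -> 'M[C]_2) :
  psdmx (choi f) -> f (delta_mx 1 1) 0 0 = 0 ->
  exists a b c y t u,
    [/\ choi f = face_choi a b c y t u, 0 <= a /\ 0 <= u,
        `|y| ^+ 2 <= a * u, `|c| ^+ 2 <= a * b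
      & a * u = `|y| ^+ 2 -> a * t = c^* * y].
Proof.
move=> psdf f0.
have H22 : choi f i2 i2 = 0 by rewrite block_mxEdr.
do 6!eexists; split; first exact: psdmx_face_choi.
- by split; exact: psdmx_diag_ge0.
- exact: psdmx_minor.
- exact: psdmx_minor.
- move=> /(psdmx_minor_eq i1 psdf) ->.
  by rewrite mulrC -psdmx_conj.
Qed.

(** The Kraus operator of the rank one case: the columns of this matrix, stacked,
    form the vector whose projection is the Choi matrix below. *)
Definition face_root (a c y : C) : 'M[C]_2 :=
  mx2 (sqrtC a) 0 (c^* / sqrtC a) (y^* / sqrtC a).

Lemma choi_face_root a c y : 0 < a ->
  choi (fun A => face_root a c y *m A *m (face_root a c y)^t*) =
  face_choi a (`|c| ^+ 2 / a) c y (c^* * y / a) (`|y| ^+ 2 / a).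
Proof.
move=> a_gt0; rewrite /face_root; move: (sqrtCK a).
have : (sqrtC a)^* = sqrtC a by rewrite geC0_conj// sqrtC_ge0 ltW.
have : sqrtC a != 0 by rewrite sqrtC_eq0 gt_eqF.
move: (sqrtC a) => r r0 rC <- {a_gt0 a}; set S := mx2 _ _ _ _.
have S00 : S 0 0 = r by rewrite mxE.
have S01 : S 0 1 = 0 by rewrite mxE.
have S10 : S 1 0 = c^* / r by rewrite mxE.
have S11 : S 1 1 = y^* / r by rewrite mxE.
have entry i j k l : (S *m delta_mx i j *m S^t*) k l = S k i * (S l j)^*.
  rewrite -(mul_delta_mx (0 : 'I_1)) mulmxA -mulmxA mxE big_ord1.
  by rewrite -colE -rowE !mxE.
clearbody S.
rewrite /choi /face_choi; congr block_mx; rewrite [LHS]mx2E !entry ?S00 ?S01 ?S10 ?S11.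
all: rewrite ?rmorphM ?fmorphV ?rmorphXn /= ?conjCK ?conjC0 ?rC ?mulr0 ?mul0r ?normCK.
all: by congr mx2; field.
Qed.

(** Precomposing with the transposition is partial transposition of the Choi
    matrix. *)
Lemma choi_comp_tr (f : 'M[C]_2 -> 'M[C]_2) A B D E :
  choi (f \o trmx) = block_mx A B D E <-> choi f = block_mx A D B E.
Proof.
have -> : choi (f \o trmx) = block_mx (f (delta_mx 0 0)) (f (delta_mx 1 0))
                                      (f (delta_mx 0 1)) (f (delta_mx 1 1)).
  by rewrite /choi /= !trmx_delta.
by rewrite /choi; split=> /eq_block_mx[-> -> -> ->].
Qed.

Lemma choi_comp_tr_inj (f g : 'M[C]_2 -> 'M[C]_2) :
  choi (f \o trmx) = choi (g \o trmx) -> choi f = choi g.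
Proof.
by move=> /eq_block_mx; rewrite /= !trmx_delta /choi => -[-> -> -> ->].
Qed.

End FaceChoi.

(** * The boundary of the positive cone *)

Section PositiveTwist.
Context {C : numClosedFieldType}.

Lemma psdmx_twist (V W : 'M[C]_2) psi A :
  positive_map psi -> psdmx A -> psdmx (twist V W psi A).
Proof.
move=> pos psdA v; rewrite -/(qform _ _ _) qform_twist; apply: pos => w.
by rewrite -/(qform _ _ _) qform_congr; apply: psdA.
Qed.

Lemma psdmx_rank1 (x : C) : psdmx (mx2 1 x^* x (x * x^*)).
Proof.
move=> v; rewrite -/(qform _ _ _) qformE !big_ord2 !mxE /=.
have := mul_conjC_ge0 (v 0 0 + x^* * v 1 0).
rewrite rmorphD rmorphM /= conjCK; congr (0 <= _); ring.
Qed.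

(** A multiple of the projection onto (1, x) is sent to a positive semidefinite
    2 x 2 matrix, whose determinant is nonnegative. *)
Lemma positive_map_ineq (V W : 'M[C]_2) psi (b u y z t x : C) :
    positive_map psi ->
    choi (twist V W psi) = block_mx (mx2 1 0 0 b) (mx2 0 y z^* t)
                                    (mx2 0 z y^* t^*) (mx2 0 0 0 u) ->
  `|y * x^* + z * x| ^+ 2 <= b + (t * x^* + t^* * x) + u * `|x| ^+ 2.
Proof.
move=> pos /eq_block_mx[e00 e01 e10 e11].
have := psdmx_minor 0 1 (psdmx_twist V W pos (psdmx_rank1 x)).
rewrite twist_sum !big_ord2 e00 e01 e10 e11 !mxE /= (normCK x).
rewrite !(mulr0, mulr1, mul1r, addr0, add0r).
have -> : x^* * y + x * z = y * x^* + z * x by ring.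
have -> : b + x^* * t + (x * t^* + x * x^* * u) =
          b + (t * x^* + t^* * x) + u * (x * x^*) by ring.
by [].
Qed.

End PositiveTwist.

(** Completing squares when A is positive gives
    t1^2 / A + t2^2 / A' <= b, hence t1^2 + t2^2 <= b A' as A < A'.  This is
    incompatible with t1^2 + t2^2 = b (A + A'), so A = 0; the form is then affine
    in s and bounded below, so t1 = 0. *)
Lemma quadratic_tangency (R : realFieldType) (A A' t1 t2 b : R) :
    (forall s r, 0 <= A * s ^+ 2 + A' * r ^+ 2 + 2 * t1 * s + 2 * t2 * r + b) ->
    A < A' -> 0 <= A /\ (0 < b -> t1 ^+ 2 + t2 ^+ 2 = b * (A + A') -> A = 0 /\ t1 = 0).
Proof.
move=> q_ge0 AA'.
have A_ge0 : 0 <= A.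
  rewrite leNgt; apply/negP => A_lt0.
  have b_ge0 : 0 <= b by have := q_ge0 0 0; lra.
  (* For this s, A s^2 <= A s = A - b, and averaging over s and - s removes t1. *)
  pose s := 1 - b / A.
  have As : A * s = A - b by rewrite /s; field; lra.
  have s_ge1 : 1 <= s.
    have : 0 <= b / - A by rewrite divr_ge0//; lra.
    by rewrite /s invrN mulrN; lra.
  have := q_ge0 s 0; have := q_ge0 (- s) 0.
  have : A * s ^+ 2 <= A - b by rewrite expr2 mulrA As; nra.
  rewrite sqrrN; lra.
split=> // b_gt0 tE.
have [A0|A_neq0] := eqVneq A 0.
  split=> //; apply/eqP; apply: contraT => t1_neq0.
  have := q_ge0 (- (b + 1) / (2 * t1)) 0; rewrite A0.
  have -> : 2 * t1 * (- (b + 1) / (2 * t1)) = - (b + 1) by field.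
  lra.
have A_gt0 : 0 < A by rewrite lt_def A_neq0.
have A'_gt0 : 0 < A' by lra.
have := q_ge0 (- t1 / A) (- t2 / A').
have -> : A * (- t1 / A) ^+ 2 + A' * (- t2 / A') ^+ 2 + 2 * t1 * (- t1 / A)
          + 2 * t2 * (- t2 / A') + b = (b * A * A' - t1 ^+ 2 * A' - t2 ^+ 2 * A) / (A * A').
  by field; rewrite A_neq0 gt_eqF.
rewrite pmulr_lge0 ?invr_gt0 ?mulr_gt0// => h.
have h1 : A * (t1 ^+ 2 + t2 ^+ 2) <= t1 ^+ 2 * A' + t2 ^+ 2 * A.
  have : 0 <= t1 ^+ 2 * (A' - A) by rewrite mulr_ge0 ?sqr_ge0//; lra.
  lra.
have h2 : 0 < b * A * A by rewrite !mulr_gt0.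
move: h1; rewrite tE; lra.
Qed.

Section ComplexBoundary.
Local Open Scope complex_scope.
Local Open Scope ring_scope.

(** The real linear map sending x to y x^* + z x has singular values |y| + |z| and
    ||y| - |z||, reached on orthogonal lines spanned by v and 'i v with
    v^2 = y z^* / |y z|.  In the coordinates x = v (s + 'i r) the inequality becomes
    a real quadratic polynomial in s and r without cross term, and the condition
    on |t| makes it degenerate: u equals the square of the larger singular value
    and t v^* is purely imaginary. *)
Lemma positivity_tangency (R : rcfType) (b u y z t : R[i]) :
    0 <= b -> 0 < u -> b + u = 1 -> y != 0 -> z != 0 ->
    (b != 0 -> `|t| ^+ 2 = 2 * b * (u - `|y| ^+ 2 - `|z| ^+ 2)) ->
    (b = 0 -> `|y| = 1 \/ `|z| = 1) ->
    (forall x : R[i], `|y * x^* + z * x| ^+ 2 <=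
                      b + (t * x^* + t^* * x) + u * `|x| ^+ 2) ->
  u = (`|y| + `|z|) ^+ 2 /\ t ^+ 2 = - (4 * b * y * z^*).
Proof.
move=> b_ge0 u_gt0 bDu y0 z0 tE yz1 pos.
have Y0 : `|y| != 0 by rewrite normr_eq0.
have Z0 : `|z| != 0 by rewrite normr_eq0.
pose v := sqrtC (y * z^* / (`|y| * `|z|)).
have v2 : v ^+ 2 = y * z^* / (`|y| * `|z|) by rewrite sqrtCK.
have vv : v * v^* = 1.
  rewrite -normCK -normrX v2 !normrM normfV norm_conjC normrM !normr_id.
  by rewrite divff ?mulf_neq0.
(* The unit complex number g is the direction of the image of v. *)
pose g := v * z / `|z|.
have gg : g * g^* = 1.
  by rewrite -normCK !normrM normfV normr_id mulfK// normCK.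
have yv : y * v^* = `|y| * g.
  apply: (mulIf (mulf_neq0 z0 (mulf_neq0 Z0 Z0))).
  transitivity (y * v^* * z * `|z| ^+ 2); first by ring.
  rewrite [`|z| ^+ 2]normCK.
  transitivity (v^* * z ^+ 2 * (y * z^*)); first by ring.
  have -> : y * z^* = v ^+ 2 * (`|y| * `|z|) by rewrite v2 divfK ?mulf_neq0.
  transitivity ((v * v^*) * v * z ^+ 2 * `|y| * `|z|); first by ring.
  by rewrite vv mul1r /g; field.
have zv : z * v = `|z| * g by rewrite /g; field.
clearbody g v.
case tvE : (t * v^*) => [t1 t2].
have t_norm : `|t| ^+ 2 = (t1 ^+ 2 + t2 ^+ 2)%:C.
  rewrite -[LHS]mulr1 -vv normCK.
  transitivity ((t * v^*) * (t * v^*)^*); first by rewrite rmorphM /= conjCK; ring.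
  by rewrite tvE; apply/eqP; rewrite eq_complex /=; apply/andP; split; apply/eqP; ring.
have [br bE] : exists br, b = br%:C by apply/complex_realP/ger0_real.
have [ur uE] : exists ur, u = ur%:C by apply/complex_realP/ger0_real/ltW.
have [Y YE] : exists Y, `|y| = Y%:C by apply/complex_realP/normr_real.
have [Z ZE] : exists Z, `|z| = Z%:C by apply/complex_realP/normr_real.
have Y_gt0 : 0 < Y by rewrite -ltcR -YE normr_gt0.
have Z_gt0 : 0 < Z by rewrite -ltcR -ZE normr_gt0.
pose A := ur - (Y + Z) ^+ 2; pose A' := ur - (Y - Z) ^+ 2.
have q_ge0 s r : 0 <= A * s ^+ 2 + A' * r ^+ 2 + 2 * t1 * s + 2 * t2 * r + br.
  pose w := s +i* r.
  have wC : w^* = s -i* r by [].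
  have := pos (v * w); rewrite -subr_ge0.
  have -> : y * (v * w)^* + z * (v * w) = g * (`|y| * w^* + `|z| * w).
    rewrite rmorphM /=; transitivity ((y * v^*) * w^* + (z * v) * w); first by ring.
    by rewrite yv zv; ring.
  have -> : t * (v * w)^* + t^* * (v * w) = (t * v^*) * w^* + (t * v^*)^* * w.
    by rewrite !rmorphM /= conjCK; ring.
  rewrite !normrM !exprMn !(normCK g) !(normCK v) gg vv !mul1r tvE !normCK.
  rewrite rmorphD !rmorphM /= conjCK !conj_normC YE ZE uE bE.
  suff -> : br%:C + ((t1 +i* t2) * w^* + (t1 +i* t2)^* * w) + ur%:C * (w * w^*) -
     (Y%:C * w^* + Z%:C * w) * (Y%:C * w + Z%:C * w^*) =
    (A * s ^+ 2 + A' * r ^+ 2 + 2 * t1 * s + 2 * t2 * r + br)%:C by rewrite ler0c.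
  have -> : (t1 +i* t2)^* = t1 -i* t2 by [].
  rewrite wC /w /A /A'; apply/eqP; rewrite eq_complex /=.
  by apply/andP; split; apply/eqP; ring.
have AA' : A < A' by rewrite /A /A'; nra.
have [A_ge0 bound] := quadratic_tangency q_ge0 AA'.
have bu1 : br + ur = 1 by apply: (@complexI R); rewrite rmorphD /= -bE -uE.
have br_ge0 : 0 <= br by rewrite -ler0c -bE.
(* If b = 0 then u = 1, but |y| + |z| > 1, against A >= 0. *)
have b_gt0 : 0 < br.
  rewrite lt_def br_ge0 andbT; apply/eqP => br0.
  have : Y = 1 \/ Z = 1.
    have [|yE|zE] := yz1; first by rewrite bE br0.
      by left; apply: (@complexI R); rewrite -YE yE.
    by right; apply: (@complexI R); rewrite -ZE zE.
  by move: A_ge0; rewrite /A => A_ge0 YZ1; clear -A_ge0 YZ1 Y_gt0 Z_gt0 br0 bu1;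
    case: YZ1; nra.
have tE' : t1 ^+ 2 + t2 ^+ 2 = br * (A + A').
  have b_neq0 : b != 0 by rewrite bE fmorph_eq0 gt_eqF.
  apply: (@complexI R); rewrite -t_norm tE// bE.
  rewrite YE ZE uE /A /A' !(rmorphM, rmorphD, rmorphN, rmorphXn) /=.
  by ring.
have [A0 t10] := bound b_gt0 tE'.
have urE : ur = (Y + Z) ^+ 2 by move: A0; rewrite /A; lra.
split; first by rewrite uE YE ZE urE rmorphXn rmorphD.
have t2E : t2 ^+ 2 = 4 * br * Y * Z.
  by move: tE'; rewrite t10 A0 /A' urE => e; lra.
have tv2 : (t * v^*) ^+ 2 = - (4 * b * `|y| * `|z|).
  have -> : 4 * b * `|y| * `|z| = (t2 ^+ 2)%:C.
    by rewrite t2E bE YE ZE !rmorphM /= rmorph_nat.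
  rewrite tvE t10; apply/eqP; rewrite eq_complex /=; apply/andP.
  by split; apply/eqP; ring.
transitivity ((t * v^*) ^+ 2 * v ^+ 2).
  transitivity (t ^+ 2 * (v * v^*) ^+ 2); last by ring.
  by rewrite vv expr1n mulr1.
by rewrite tv2 v2; field; rewrite Y0 Z0.
Qed.

End ComplexBoundary.

(** * The forced splitting *)

(** The hypotheses say that Cauchy-Schwarz for (sqrt a1, sqrt a2) and
    (sqrt u1, sqrt u2) is an equality.  The excess a1 u1 + a2 u2 + a1 u2 + a2 u1
    - (Y + Z)^2 = 0 is a sum of three nonnegative terms, the last by the inequality
    between arithmetic and geometric means. *)
Lemma cauchy_schwarz_eq (C : numClosedFieldType) (a1 a2 u1 u2 Y Z : C) :
    0 <= a1 -> 0 <= a2 -> 0 <= u1 -> 0 <= u2 -> 0 <= Y -> 0 <= Z ->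
    a1 + a2 = 1 -> Y ^+ 2 <= a1 * u1 -> Z ^+ 2 <= a2 * u2 ->
    u1 + u2 = (Y + Z) ^+ 2 ->
  [/\ a1 * u1 = Y ^+ 2, a2 * u2 = Z ^+ 2, u1 = Y * (Y + Z) & u2 = Z * (Y + Z)].
Proof.
move=> a1_ge0 a2_ge0 u1_ge0 u2_ge0 Y_ge0 Z_ge0 a1D Y_le Z_le uE.
pose P := a1 * u2; pose Q := a2 * u1.
have P_ge0 : 0 <= P by rewrite mulr_ge0.
have Q_ge0 : 0 <= Q by rewrite mulr_ge0.
have PQ : Y ^+ 2 * Z ^+ 2 <= P * Q.
  have -> : P * Q = (a1 * u1) * (a2 * u2) by rewrite /P /Q; ring.
  by rewrite ler_pM// exprn_ge0.
have sqPQ : (P + Q) ^+ 2 = (P - Q) ^+ 2 + 4 * (P * Q) by ring.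
have PmQ : 0 <= (P - Q) ^+ 2.
  by rewrite real_exprn_even_ge0// rpredB// ger0_real.
have PDQ : 2 * (Y * Z) <= P + Q.
  rewrite -(ler_pXn2r (n := 2))// ?nnegrE ?mulr_ge0 ?addr_ge0//.
  rewrite sqPQ; have -> : (2 * (Y * Z)) ^+ 2 = 0 + 4 * (Y ^+ 2 * Z ^+ 2) by ring.
  by rewrite lerD// ler_wpM2l.
have sum0 : a1 * u1 - Y ^+ 2 + (a2 * u2 - Z ^+ 2) + (P + Q - 2 * (Y * Z)) = 0.
  transitivity ((a1 + a2) * (u1 + u2) - (Y + Z) ^+ 2); first by rewrite /P /Q; ring.
  by rewrite a1D uE mul1r subrr.
move: Y_le Z_le PDQ sum0; rewrite -subr_ge0 => Y_le; rewrite -subr_ge0 => Z_le.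
rewrite -subr_ge0 => PDQ /eqP.
rewrite (paddr_eq0 (addr_ge0 Y_le Z_le) PDQ) (paddr_eq0 Y_le Z_le) !subr_eq0.
move=> /andP[/andP[/eqP e1 /eqP e2] /eqP e3].
have PQE : P * Q = (Y * Z) ^+ 2.
  have -> : P * Q = (a1 * u1) * (a2 * u2) by rewrite /P /Q; ring.
  by rewrite e1 e2 exprMn.
have {PmQ} : (P - Q) ^+ 2 = 0.
  move: sqPQ; rewrite e3 PQE => e.
  by apply: (addIr (4 * (Y * Z) ^+ 2)); rewrite -e; ring.
move=> /eqP; rewrite sqrf_eq0 subr_eq0 => /eqP PQ0.
have two0 : 2 != 0 :> C by rewrite pnatr_eq0.
have PE : P = Y * Z.
  by apply: (mulfI two0); rewrite -e3 -PQ0; ring.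
split=> //.
- transitivity (a1 * u1 + Q); first by rewrite /Q -mulrDl a1D mul1r.
  by rewrite -PQ0 PE e1; ring.
- transitivity (a2 * u2 + P); first by rewrite /P -mulrDl addrC a1D mul1r.
  by rewrite PE e2; ring.
Qed.

Section Splitting.
Context {C : numClosedFieldType}.
Variables b y z t : C.
Local Notation m := (`|y| + `|z|).
Hypotheses (b_ge0 : 0 <= b) (y0 : y != 0) (z0 : z != 0).
Hypotheses (tE : t ^+ 2 = - (4 * b * y * z^*)).

(** The common off-diagonal entry c.  Its conjugate is the only value for which
    the rank one matrix with entries |y| / m and y has t / 2 in its corner. *)
Definition offdiag : C := (`|y| * t / (2 * m * y))^*.

Definition cp_choi :=
  face_choi (`|y| / m) (`|z| * b / m) offdiag y (t / 2) (`|y| * m).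

(** The Choi matrix of the second summand precomposed with the transposition,
    so that both summands are handled by the same family of matrices. *)
Definition cocp_choi :=
  face_choi (`|z| / m) (`|y| * b / m) (- offdiag) z (t^* / 2) (`|z| * m).

Let Y0 : `|y| != 0. Proof. by rewrite normr_eq0. Qed.
Let Z0 : `|z| != 0. Proof. by rewrite normr_eq0. Qed.
Let Y_gt0 : 0 < `|y|. Proof. by rewrite normr_gt0. Qed.
Let Z_gt0 : 0 < `|z|. Proof. by rewrite normr_gt0. Qed.
Let m_gt0 : 0 < m. Proof. by rewrite addr_gt0. Qed.
Let m0 : m != 0. Proof. by rewrite gt_eqF. Qed.
Let two0 : 2 != 0 :> C. Proof. by rewrite pnatr_eq0. Qed.
Let bC : b^* = b. Proof. exact: geC0_conj. Qed.
Let yC0 : y^* != 0. Proof. by rewrite conjC_eq0. Qed.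
Let mC : m^* = m. Proof. exact/geC0_conj/ltW. Qed.
Let sqY : `|y| ^+ 2 = y * y^*. Proof. exact: normCK. Qed.
Let sqZ : `|z| ^+ 2 = z * z^*. Proof. exact: normCK. Qed.

Lemma sqr_norm_t : `|t| ^+ 2 = 4 * b * `|y| * `|z|.
Proof.
rewrite -normrX tE normrN !normrM norm_conjC (ger0_norm b_ge0).
by rewrite ger0_norm// ler0n.
Qed.

Lemma offdiagC : offdiag^* = `|y| * t / (2 * m * y).
Proof. by rewrite conjCK. Qed.

Lemma offdiagE : offdiag = t^* * y / (2 * m * `|y|).
Proof.
rewrite /offdiag fmorph_div !rmorphM /= mC conj_normC conjC_nat.
transitivity (`|y| ^+ 2 * t^* / (2 * m * y^* * `|y|)); first by field; rewrite Y0 yC0 m0.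
by rewrite sqY; field; rewrite Y0 yC0 m0.
Qed.

Lemma sqr_offdiag : offdiag ^+ 2 = - (b / m ^+ 2 * y * z).
Proof.
have tCE : t^* ^+ 2 = - (4 * b * y^* * z).
  by rewrite -rmorphXn /= tE rmorphN !rmorphM /= conjCK bC conjC_nat.
rewrite offdiagE.
transitivity (t^* ^+ 2 * y ^+ 2 / (4 * m ^+ 2 * `|y| ^+ 2)); first by field; rewrite Y0 m0.
by rewrite tCE sqY; field; rewrite y0 yC0 m0.
Qed.

Lemma sqr_norm_offdiag : `|offdiag| ^+ 2 = b * `|y| * `|z| / m ^+ 2.
Proof.
rewrite -normrX sqr_offdiag normrN !normrM normfV normrX.
rewrite (ger0_norm b_ge0) (gtr0_norm m_gt0).
by field.
Qed.

Lemma cp_corner : offdiag^* * y / (`|y| / m) = t / 2.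
Proof. by rewrite offdiagC; field; rewrite Y0 y0 m0. Qed.

(** The corner of the second matrix is determined by c as well; the phase of t,
    known from tE, makes the two values agree. *)
Lemma cocp_corner : (- offdiag)^* * z / (`|z| / m) = t^* / 2.
Proof.
rewrite rmorphN /= offdiagC.
case: (eqVneq t 0) => [->|t0]; first by rewrite conjC0 !(mulr0, mul0r, oppr0).
apply: (mulfI t0).
transitivity (- (t ^+ 2 * z * `|y| / (2 * y * `|z|))); first by field; rewrite Z0 y0 m0.
transitivity (`|t| ^+ 2 / 2); last by rewrite normCK; field.
rewrite tE sqr_norm_t.
transitivity (2 * b * `|y| * (z * z^*) / `|z|); first by field; rewrite Z0 y0.
by rewrite -sqZ; field.
Qed.

Lemma choi_cp_root :
  choi (fun A => face_root (`|y| / m) offdiag y *m A *m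
                 (face_root (`|y| / m) offdiag y)^t*) = cp_choi.
Proof.
rewrite choi_face_root ?divr_gt0// cp_corner sqr_norm_offdiag.
by congr face_choi; field; rewrite ?Y0 ?m0.
Qed.

Lemma choi_cocp_root :
  choi (fun A => face_root (`|z| / m) (- offdiag) z *m A *m
                 (face_root (`|z| / m) (- offdiag) z)^t*) = cocp_choi.
Proof.
rewrite choi_face_root ?divr_gt0// cocp_corner normrN sqr_norm_offdiag.
by congr face_choi; field; rewrite ?Z0 ?m0.
Qed.

(** Equality in Cauchy-Schwarz fixes the diagonal entries a and u of both
    summands, and makes the corresponding minors vanish.  Then |t1| = |t2| = m |c|,
    where t1 + t2 = t are the two corners.  The minors of a and b give
    m^2 |c|^2 <= b |y| |z|, while the parallelogram law gives
    4 m^2 |c|^2 = |t|^2 + |t1 - t2|^2 with |t|^2 = 4 b |y| |z|; so t1 = t2 and the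
    remaining minors vanish too. *)
Lemma splitting_forced (f f1 f2 : 'M[C]_2 -> 'M[C]_2) :
    choi f = block_mx (mx2 1 0 0 b) (mx2 0 y z^* t)
                      (mx2 0 z y^* t^*) (mx2 0 0 0 (m ^+ 2)) ->
    (forall A, f A = f1 A + f2 A) ->
    psdmx (choi f1) -> psdmx (choi (f2 \o trmx)) ->
    f1 (delta_mx 1 1) 0 0 = 0 -> f2 (delta_mx 1 1) 0 0 = 0 ->
  choi f1 = cp_choi /\ choi (f2 \o trmx) = cocp_choi.
Proof.
move=> choi_f fD psd1 psd2 f1_0 f2_0.
have f2_0' : (f2 \o trmx) (delta_mx 1 1) 0 0 = 0 by rewrite /= trmx_delta.
have [a1 [b1 [c1 [y1 [t1 [u1 [e1 [a1_ge0 u1_ge0] y1_le c1_le min1]]]]]]] :=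
  psdmx_choi_face psd1 f1_0.
have [a2 [b2 [c2 [z2 [s2 [u2 [e2 [a2_ge0 u2_ge0] z2_le c2_le min2]]]]]]] :=
  psdmx_choi_face psd2 f2_0'.
rewrite e1 e2.
have /eq_block_mx[e1_00 e1_01 _ e1_11] := e1.
move/choi_comp_tr: e2 => /eq_block_mx[e2_00 e2_01 _ e2_11].
move: choi_f => /eq_block_mx[].
rewrite !fD e1_00 e1_01 e1_11 e2_00 e2_01 e2_11 !mx2D.
move=> /mx2_inj[aD cD _ bD] /mx2_inj[_ yE zE tD] _ /mx2_inj[_ _ _ uD].
move: yE zE; rewrite addr0 add0r => y1E /(canRL conjCK).
rewrite conjCK => z2E; subst y1 z2.
move/eqP: cD; rewrite addrC addr_eq0 => /eqP c2E; subst c2.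
have [au1 au2 u1E u2E] := cauchy_schwarz_eq a1_ge0 a2_ge0 u1_ge0 u2_ge0
  (ltW Y_gt0) (ltW Z_gt0) aD y1_le z2_le uD.
have a1E : a1 = `|y| / m.
  apply: (mulIf (mulf_neq0 Y0 m0)); rewrite -u1E au1 u1E; field; exact: m0.
have a2E : a2 = `|z| / m.
  apply: (mulIf (mulf_neq0 Z0 m0)); rewrite -u2E au2 u2E; field; exact: m0.
have t1E : t1 = c1^* * y * m / `|y|.
  apply: (mulfI (x := a1)); first by rewrite a1E mulf_neq0 ?invr_eq0.
  by rewrite min1// a1E; field; rewrite Y0 m0.
have s2E : s2 = - (c1^* * z * m / `|z|).
  apply: (mulfI (x := a2)); first by rewrite a2E mulf_neq0 ?invr_eq0.
  by rewrite min2// a2E rmorphN /=; field; rewrite Z0 m0.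
pose n := `|c1| ^+ 2.
have norm_t1 : `|t1| ^+ 2 = n * m ^+ 2.
  rewrite t1E !normrM normfV norm_conjC normr_id (gtr0_norm m_gt0) /n.
  by field.
have norm_s2 : `|s2| ^+ 2 = n * m ^+ 2.
  rewrite s2E normrN !normrM normfV norm_conjC normr_id (gtr0_norm m_gt0) /n.
  by field.
have d1 : 0 <= `|y| * b1 - n * m.
  rewrite subr_ge0 -ler_pdivlMr//.
  by move: c1_le; rewrite a1E mulrAC.
have d2 : 0 <= `|z| * b2 - n * m.
  rewrite subr_ge0 -ler_pdivlMr//.
  by move: c2_le; rewrite a2E mulrAC normrN.
have parallelogram : `|t| ^+ 2 + `|t1 - s2^*| ^+ 2 = 4 * (n * m ^+ 2).
  rewrite -tD !normCK !(rmorphD, rmorphN) /= conjCK.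
  transitivity (2 * (t1 * t1^*) + 2 * (s2 * s2^*)); first by ring.
  by rewrite -!normCK norm_t1 norm_s2; ring.
(* Three nonnegative quantities, two minors and a squared distance, add up to 0. *)
have : (`|y| * b1 - n * m) * `|z| + (`|z| * b2 - n * m) * `|y| +
       `|t1 - s2^*| ^+ 2 / 4 = 0.
  have -> : `|t1 - s2^*| ^+ 2 = 4 * (n * m ^+ 2) - `|t| ^+ 2.
    by rewrite -parallelogram; ring.
  by rewrite sqr_norm_t -bD; field.
move=> /eqP; rewrite !paddr_eq0 ?addr_ge0 ?mulr_ge0 ?invr_ge0 ?exprn_ge0 ?ler0n//.
rewrite !mulf_eq0 (negPf Z0) (negPf Y0) !orbF invr_eq0 pnatr_eq0 !orbF orbb.
rewrite normr_eq0 !subr_eq0 => /andP[/andP[/eqP b1E /eqP b2E] /eqP t1s2].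
have t1_half : t1 = t / 2 by rewrite -tD -t1s2; field.
have s2_half : s2 = t^* / 2.
  by rewrite -[LHS]conjCK -t1s2 t1_half rmorphM fmorphV /= conjC_nat.
have c1E : c1 = offdiag.
  rewrite -[c1]conjCK /offdiag; congr (_^*).
  transitivity (t1 * `|y| / (m * y)); first by rewrite t1E; field; rewrite Y0 y0 m0.
  by rewrite t1_half; field; rewrite y0 m0.
have nE : n = b * `|y| * `|z| / m ^+ 2 by rewrite /n c1E sqr_norm_offdiag.
have b1E' : b1 = `|z| * b / m.
  by apply: (mulfI Y0); rewrite b1E nE; field.
have b2E' : b2 = `|y| * b / m.
  by apply: (mulfI Z0); rewrite b2E nE; field.
by rewrite a1E a2E b1E' b2E' c1E u1E u2E t1_half s2_half.
Qed.

End Splitting.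

(** * The decomposition *)

Theorem theorem2p7 (R : realType) (phi : 'End('M[R[i]]_2))
  (V W : 'M[R[i]]_2) (b u y z t : R[i])
  (phi_ext : extremal_point P1 phi)
  (V_unitary : V \is unitarymx) (W_unitary : W \is unitarymx)
  (b_ge0 : 0 <= b) (u_ge0 : 0 <= u) (bDu : b + u = 1)
  (choi_phi : choi (twist V W phi) =
     block_mx (mx2 1 0
                   0 b)    (mx2 0    y
                                z^*  t)
              (mx2 0   z
                   y^* t^*) (mx2 0 0
                                 0 u))
  (tE : b != 0 -> `|t| ^+ 2 = 2 * b * (u - `|y| ^+ 2 - `|z| ^+ 2))
  (yz1 : b = 0 -> `|y| = 1 \/ `|z| = 1)
  (u_gt0 : 0 < u) (y_neq0 : y != 0) (z_neq0 : z != 0) :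
  let xi := W *m delta_mx 1 0 : 'cV[R[i]]_2 in
  let eta := V *m delta_mx 0 0 : 'cV[R[i]]_2 in
  (exists! p, decomposition phi xi eta p) /\
  (forall phi1 phi2 : 'End('M[R[i]]_2), decomposition phi xi eta (phi1, phi2) ->
   exists c : R[i],
   [/\ c ^+ 2 = - ((1 - u) * u^-1 * y * z),
       choi (twist V W phi1) =
         block_mx (mx2 (`|y| / sqrtC u) c
                       c^*              (`|z| * (1 - u) / sqrtC u))
                  (mx2 0 y
                       0 (t / 2))
                  (mx2 0   0
                       y^* (t^* / 2))
                  (mx2 0 0
                       0 (`|y| * sqrtC u))
     & choi (twist V W phi2) =
         block_mx (mx2 (`|z| / sqrtC u) (- c)
                       (- c^*)          (`|y| * (1 - u) / sqrtC u))
                  (mx2 0   0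
                       z^* (t / 2))
                  (mx2 0 z
                       0 (t^* / 2))
                  (mx2 0 0
                       0 (`|z| * sqrtC u))]).
Proof.
set f := twist V W phi in choi_phi.
have [[phi_pos _] _] := phi_ext.
have [uE t2E] := positivity_tangency b_ge0 u_gt0 bDu y_neq0 z_neq0 tE yz1
  (fun x => positive_map_ineq x phi_pos choi_phi).
move=> xi eta.
have bE : 1 - u = b by rewrite -bDu addrK.
have sqrtu : sqrtC u = `|y| + `|z| by rewrite uE sqrCK ?addr_ge0.
have m0 : `|y| + `|z| != 0 by rewrite -sqrtu sqrtC_eq0 gt_eqF.
have forced p : decomposition phi xi eta p ->
    choi (twist V W p.1) = cp_choi b y z t /\
    choi (twist V W p.2 \o trmx) = cocp_choi b y z t.
  case=> [[_ face1] [_ face2] cp cocp phiE].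
  move/(Fface_twist_eq0 V_unitary W_unitary)/matrixP/(_ 0 0): face1.
  rewrite [LHS]mxE [RHS]mxE => f1_0.
  move/(Fface_twist_eq0 V_unitary W_unitary)/matrixP/(_ 0 0): face2.
  rewrite [LHS]mxE [RHS]mxE => f2_0.
  apply: (splitting_forced b_ge0 y_neq0 z_neq0 t2E (f := f)) => //.
  - by rewrite choi_phi uE.
  - by move=> A; rewrite /f phiE twistD.
  - exact: completely_positive_choi.
  - exact: completely_copositive_choi.
have halfC x : (x / 2)^* = x^* / 2 :> R[i] by rewrite fmorph_div rmorph_nat.
pose m := `|y| + `|z|.
pose S1 := face_root (`|y| / m) (offdiag y z t) y.
pose S2 := face_root (`|z| / m) (- offdiag y z t) z.
pose p1 := congr_map (V *m S1 *m W^t*).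
pose p2 := cocongr_map (V *m S2 *m W^T).
have choi_p1 : choi (twist V W p1) = cp_choi b y z t.
  rewrite -(choi_cp_root b_ge0 y_neq0 z_neq0 t2E).
  by rewrite /choi !(twist_congr_map V_unitary W_unitary).
have choi_p2 : choi (twist V W p2 \o trmx) = cocp_choi b y z t.
  rewrite -(choi_cocp_root b_ge0 y_neq0 z_neq0 t2E).
  by rewrite /choi /= !(twist_cocongr_map V_unitary W_unitary) !trmxK.
have pos1 : positive_map p1 by exact: congr_map_pos.
have pos2 : positive_map p2 by exact: cocongr_map_pos.
have cp1 : completely_positive p1 by exact: congr_map_cp.
have cocp2 : completely_copositive p2 by exact: cocongr_map_cocp.
clearbody p1 p2.
have dec : decomposition phi xi eta (p1, p2).
  have /eq_block_mx[e1_00 e1_01 e1_10 e1_11] := choi_p1.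
  have /choi_comp_tr/eq_block_mx[e2_00 e2_01 e2_10 e2_11] := choi_p2.
  split=> /=.
  - split; first exact: pos1.
    apply/(Fface_twist_eq0 V_unitary W_unitary); rewrite e1_11.
    by apply/matrixP => i j; rewrite !mxE; case: ifP.
  - split; first exact: pos2.
    apply/(Fface_twist_eq0 V_unitary W_unitary); rewrite e2_11.
    by apply/matrixP => i j; rewrite !mxE; case: ifP.
  - exact: cp1.
  - exact: cocp2.
  - apply: (choi_twist_inj V_unitary W_unitary); rewrite [LHS]choi_phi /choi !twistD.
    rewrite e1_00 e1_01 e1_10 e1_11 e2_00 e2_01 e2_10 e2_11 !mx2D.
    rewrite !(addr0, add0r, rmorphN, subrr) /=.
    by rewrite uE !halfC conjCK; congr block_mx; congr mx2; field.
have choiP p : decomposition phi xi eta p -> p = (p1, p2).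
  case: p => q1 q2 /forced /= [e1 e2]; congr pair.
    exact: (choi_twist_inj V_unitary W_unitary (etrans e1 (esym choi_p1))).
  apply: (choi_twist_inj V_unitary W_unitary).
  exact: choi_comp_tr_inj (etrans e2 (esym choi_p2)).
split; first by exists (p1, p2); split=> // p /choiP.
move=> phi1 phi2 /forced /= [choi1 choi2]; exists (offdiag y z t).
rewrite sqrtu bE; split.
- by rewrite (sqr_offdiag b_ge0 y_neq0 z_neq0 t2E) -uE.
- by move: choi1; rewrite /cp_choi /face_choi halfC.
- by move: choi2; rewrite /cocp_choi /face_choi halfC conjCK rmorphN => /choi_comp_tr.
Qed.
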